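(* For all positive integers $q$ and $n$, the following six infinite product identities hold: \[ \prod_{k = 1}^\infty \frac{F_{8nk + 8nq - 4n} + ( - 1)^{k - 1} F_{8nq} }{F_{8nk + 8nq - 4n} + ( - 1)^k F_{8nq} } = \prod_{k = 1}^q \frac{L_{2n(4k - 3)} F_{2n(4k - 1)} }{F_{2n(4k - 3)} L_{2n(4k - 1)} }, \] \[ \prod_{k = 1}^\infty \frac{F_{(4n - 2)(2q + 2k - 1)} + ( - 1)^{k - 1} F_{(2n - 1)4q} }{F_{(4n - 2)(2q + 2k - 1)} + ( - 1)^k F_{(2n - 1)4q} } = \prod_{k = 1}^q \frac{F_{(2n - 1)(4k - 3)} L_{(2n - 1)(4k - 1)} }{L_{(2n - 1)(4k - 3)} F_{(2n - 1)(4k - 1)} }, \] \[ \prod_{k = 1}^\infty \frac{L_{(2n - 1)(2q + 2k - 1)} + ( - 1)^{k - 1} \sqrt 5 F_{(2n - 1)2q} }{L_{(2n - 1)(2q + 2k - 1)} + ( - 1)^k \sqrt 5 F_{(2n - 1)2q} } = \prod_{k = 1}^q \frac{(F_{(2n - 1)(4k - 3)} \sqrt 5 + 2)L_{(2n - 1)(4k - 1)} }{(F_{(2n - 1)(4k - 1)} \sqrt 5 + 2)L_{(2n - 1)(4k - 3)} }, \] \[ \prod_{k = 1}^\infty \frac{L_{8n(k + q - 1)} + ( - 1)^{k - 1} L_{4n(2q - 1)} }{L_{8n(k + q - 1)} + ( - 1)^k L_{4n(2q - 1)} } = \frac{1}{\sqrt 5 }\prod_{k = 1}^q \frac{L_{2n(4k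 - 3)} }{F_{2n(4k - 3)} } \prod_{k = 1}^{q - 1} \frac{F_{2n(4k - 1)} }{L_{2n(4k - 1)} }, \] \[ \prod_{k = 1}^\infty \frac{L_{(8n - 4)(k + q - 1)} + ( - 1)^{k - 1} L_{(4n - 2)(2q - 1)} }{L_{(8n - 4)(k + q - 1)} + ( - 1)^k L_{(4n - 2)(2q - 1)} } = \sqrt 5 \prod_{k = 1}^q \frac{F_{(2n - 1)(4k - 3)} }{L_{(2n - 1)(4k - 3)} } \prod_{k = 1}^{q - 1} \frac{L_{(2n - 1)(4k - 1)} }{F_{(2n - 1)(4k - 1)} }, \] \[ \prod_{k = 1}^\infty \frac{L_{(4n - 2)(q + k - 1)} + ( - 1)^{k - 1} \sqrt 5 F_{(2n - 1)(2q - 1)} }{L_{(4n - 2)(q + k - 1)} + ( - 1)^k \sqrt 5 F_{(2n - 1)(2q - 1)} } =\prod_{k = 1}^q \frac{F_{(2n - 1)(4k - 3)} \sqrt 5 + 2}{L_{(2n - 1)(4k - 3)} } \prod_{k = 1}^{q - 1} \frac{L_{(2n - 1)(4k - 1)} }{F_{(2n - 1)(4k - 1)} \sqrt 5 + 2}. \]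
   Context: The Fibonacci numbers $F_j$ and Lucas numbers $L_j$ are defined for integers $j\ge 0$ by $F_0=0$, $F_1=1$, $F_j=F_{j-1}+F_{j-2}$ and $L_0=2$, $L_1=1$, $L_j=L_{j-1}+L_{j-2}$. Here $\sqrt5$ is the positive real square root of $5$. An empty product $\prod_{k=1}^0$ equals $1$. *)

(* Defs.v *)
From HB Require Import structures.
From mathcomp Require Import all_boot all_order all_algebra.
From mathcomp Require Import all_classical all_reals all_analysis.

Set Implicit Arguments.
Unset Strict Implicit.
Unset Printing Implicit Defensive.

Import Order.TTheory GRing.Theory Num.Theory.
Import numFieldNormedType.Exports.

Local Open Scope classical_set_scope.
Local Open Scope ring_scope.

Fixpoint fib (j : nat) : nat :=
  match j with
  | 0 => 0%N
  | 1 => 1%N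
  | (j''.+1 as j').+1 => (fib j' + fib j'')%N
  end.

Fixpoint lucas (j : nat) : nat :=
  match j with
  | 0 => 2%N
  | 1 => 1%N
  | (j''.+1 as j').+1 => (lucas j' + lucas j'')%N
  end.

(* \prod_(k = 1)^oo a k = l, in the usual sense for products without zero
   factors: the partial products tend to l and l is nonzero. Since x / 0 = 0,
   the condition l != 0 also ensures that, when the a k are fractions, none of
   their denominators vanishes. *)
Definition infprod_eq (R : realType) (a : nat -> R) (l : R) : Prop :=
  (fun N : nat => \prod_(1 <= k < N.+1) a k) @ \oo --> l /\ l != 0.

(* Main.v *)
(* Let phi be the golden ratio. By Binet's formulas each factor has the form
   (X (2k-1+r) + (-1)^(k-1) X r) / (X (2k-1+r) + (-1)^k X r) where
   X j = w^j - (-1)^r w^(-j), w is a power of phi, and r is 2q in the first three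
   identities and 2q-1 in the last three. The sum-to-product formulas turn it into
   e k / e (k + r) with e k = (w^(2k-1) - (-1)^k) / (w^(2k-1) + (-1)^k). As e k
   tends to 1, the product telescopes to e 1 * ... * e r, and Binet's formulas give
   back the right-hand sides. *)
Require Import Defs.
From HB Require Import structures.
From mathcomp Require Import all_boot all_order all_algebra.
From mathcomp Require Import all_classical all_reals all_analysis.
From mathcomp Require Import ring lra zify.
Import Order.TTheory GRing.Theory Num.Theory.
Import numFieldNormedType.Exports.
Local Open Scope classical_set_scope.
Local Open Scope ring_scope.

(** * Telescoping infinite products *)

Section InfiniteProducts.
Variable R : realType.
Implicit Types (e a b : nat -> R) (w : R).

Lemma eq_prod_pos a b N : (forall k, (0 < k)%N -> a k = b k) ->
  \prod_(1 <= k < N) a k = \prod_(1 <= k < N) b k.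
Proof.
move=> ab; rewrite big_nat_cond [RHS]big_nat_cond.
by apply: eq_bigr => k /andP[/andP[k0 _] _]; rewrite ab.
Qed.

Lemma prod_pos_neq0 a N : (forall k, (0 < k)%N -> a k != 0) ->
  \prod_(1 <= k < N) a k != 0.
Proof.
move=> a0; rewrite prodf_seq_neq0; apply/allP => k; rewrite mem_index_iota.
by move=> /andP[k0 _]; rewrite a0.
Qed.

Lemma eq_infprod a b (l : R) : (forall k, (0 < k)%N -> a k = b k) ->
  infprod_eq a l -> infprod_eq b l.
Proof.
move=> ab [al l0]; split=> //; rewrite (_ : (fun N => _) =
  (fun N => \prod_(1 <= k < N.+1) a k)) //.
by apply/funext => N; apply: eq_prod_pos => k k0; rewrite ab.
Qed.

(** Telescoping with step [r]: all but the first [r] numerators cancel against denominators, leaving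
    the [r] denominators just beyond [N]. By induction on [N], the window of these denominators
    slides by one. *)
Lemma prod_shift_ratio e r N : (forall k, (0 < k)%N -> e k != 0) ->
  \prod_(1 <= k < N.+1) (e k / e (k + r)%N) =
  \prod_(1 <= k < r.+1) e k / \prod_(1 <= k < r.+1) e (N + k)%N.
Proof.
move=> e0; have P0 M : \prod_(1 <= k < r.+1) e (M + k)%N != 0.
  by apply: prod_pos_neq0 => k k0; apply: e0; lia.
elim: N => [|N IH]; first by rewrite big_geq // divff // (P0 0%N).
rewrite big_nat_recr //= IH -mulrA; congr (_ * _).
(* Both sides are the product of [e] over the indices from [N + 1] to [N + 1 + r]. *)
have : e N.+1 * \prod_(1 <= k < r.+1) e (N.+1 + k)%N
     = \prod_(1 <= k < r.+1) e (N + k)%N * e (N.+1 + r)%N.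
  elim: r {IH P0} => [|r IH]; first by rewrite !big_geq // mulr1 mul1r addn0.
  by rewrite !(@big_nat_recr _ _ _ r.+1) //= mulrA IH addSnnS.
have := P0 N; have := P0 N.+1; have := e0 (N.+1 + r)%N isT; have := e0 N.+1 isT.
set A := e N.+1; set B := e (N.+1 + r)%N.
set P := \prod_(_ <= _ < _) e (N + _)%N; set Q := bigop _ _ _.
move=> A0 B0 Q0 P0' AQ; have -> : A = P * B / Q by rewrite -AQ mulfK.
by field; rewrite B0 Q0 P0'.
Qed.

(** The number [r] of remaining denominators is fixed and each tends to 1, so their product tends to
    1. *)
Lemma infprod_shift_ratio e r : (forall k, (0 < k)%N -> e k != 0) ->
  e k @[k --> \oo] --> (1 : R) ->
  infprod_eq (fun k => e k / e (k + r)%N) (\prod_(1 <= k < r.+1) e k).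
Proof.
move=> e0 e1; split; last first.
  exact: prod_pos_neq0.
under eq_fun do rewrite prod_shift_ratio //.
set P := \prod_(1 <= k < r.+1) e k.
rewrite -[X in nbhs X](divr1 P).
apply: cvgM; first exact: cvg_cst.
apply: cvgV; rewrite ?oner_neq0 // {P}.
elim: r => [|r IH].
  by under eq_fun do rewrite big_geq //; exact: cvg_cst.
under eq_fun do rewrite big_nat_recr //=.
rewrite -[X in nbhs X]mulr1; apply: cvgM => //.
by have := e1; rewrite -(cvg_shiftn r.+1).
Qed.

(** * Hyperbolic form of the factors *)

(* coth ((2 k - 1) x / 2) raised to the power (-1)^(k - 1), with w = exp x. *)
Definition sgn_ratio w k : R :=
  (w ^+ (2 * k - 1) - (-1) ^+ k) / (w ^+ (2 * k - 1) + (-1) ^+ k).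

Lemma exprn_sgn_neq0 w j k : 1 < w -> (0 < j)%N ->
  (w ^+ j - (-1) ^+ k != 0) && (w ^+ j + (-1) ^+ k != 0).
Proof.
move=> w1 j0; have : 1 < w ^+ j by rewrite exprn_egt1 // -lt0n.
by rewrite -signr_odd; case: (odd k); rewrite ?expr1 ?expr0 => h;
  apply/andP; split; apply: lt0r_neq0; lra.
Qed.

Lemma sgn_ratio_neq0 w k : 1 < w -> (0 < k)%N -> sgn_ratio w k != 0.
Proof.
move=> w1 k0; have j0 : (0 < 2 * k - 1)%N by lia.
by have /andP[? ?] := exprn_sgn_neq0 _ _ k w1 j0; rewrite mulf_neq0 ?invr_eq0.
Qed.

(** Dividing through by [w ^+ (2 * k - 1)] gives [(1 - x k) / (1 + x k)], where [x] is a geometric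
    sequence of ratio [- w ^- 2], hence tends to 0. *)
Lemma cvg_sgn_ratio w : 1 < w -> sgn_ratio w k @[k --> \oo] --> (1 : R).
Proof.
move=> w1; have w0 : w != 0 by apply: lt0r_neq0; lra.
pose x k := w * (- w ^- 2) ^+ k.
have x0 : x k @[k --> \oo] --> (0 : R).
  rewrite -(mulr0 w); apply: cvgM; first exact: cvg_cst.
  apply: cvg_expr; rewrite normrN ger0_norm ?invr_ge0 ?exprn_ge0 //; last lra.
  by rewrite invf_lt1 ?exprn_egt1 // exprn_gt0 //; lra.
suff : (1 - x k) / (1 + x k) @[k --> \oo] --> (1 : R).
  apply: cvg_trans; apply: near_eq_cvg; near=> k.
  (* At [k = 0] the truncated exponent [2 * k - 1] is 0 rather than -1, so the two expressions agree
     only for positive [k]. *)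
  have k0 : (0 < k)%N by near: k; exists 1%N.
  have j0 : (0 < 2 * k - 1)%N by lia.
  have /andP[_ h] := exprn_sgn_neq0 _ _ k w1 j0.
  have X0 : w ^+ (2 * k - 1) != 0 by rewrite expf_neq0.
  have -> : x k = (-1) ^+ k / w ^+ (2 * k - 1).
    rewrite /x (exprNn (w ^- 2)) exprVn -exprM.
    have {1}-> : (2 * k = (2 * k - 1).+1)%N by lia.
    by rewrite exprS; field; rewrite w0 X0.
  by rewrite /sgn_ratio; field; rewrite h X0.
suff : (1 - x k) / (1 + x k) @[k --> \oo] --> ((1 - 0) / (1 + 0) : R).
  by rewrite subr0 addr0 divr1.
apply: cvgM; first by apply: cvgB => //; exact: cvg_cst.
apply: cvgV; first by rewrite addr0 oner_neq0.
by apply: cvgD => //; exact: cvg_cst.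
Unshelve. all: by end_near.
Qed.

(* With w = exp x, this is 2 sinh (j x) for even r and 2 cosh (j x) for odd r. *)
Definition hyp w r j : R := w ^+ j - (-1) ^+ r * w ^- j.

(** Sum-to-product: numerator and denominator each split into a factor in [w ^+ (2 * k - 1)] and one
    in [w ^+ (2 * (k + r) - 1)], over a common divisor that cancels. *)
Lemma sgn_ratio_shift w r k : 1 < w -> (0 < k)%N ->
  (hyp w r (2 * k - 1 + r) + (-1) ^+ (k - 1) * hyp w r r) /
  (hyp w r (2 * k - 1 + r) + (-1) ^+ k * hyp w r r) =
  sgn_ratio w k / sgn_ratio w (k + r).
Proof.
move=> w1 k0; have w0 : w != 0 by apply: lt0r_neq0; lra.
have j0 : (0 < 2 * k - 1)%N by lia.
have j0' : (0 < 2 * (k + r) - 1)%N by lia.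
have := exprn_sgn_neq0 _ _ (k + r) w1 j0'; have := exprn_sgn_neq0 _ _ k w1 j0.
have -> : (-1) ^+ (k - 1) = - (-1) ^+ k :> R.
  by case: k k0 {j0 j0'} => // k _; rewrite subn1 exprS /= mulN1r opprK.
rewrite /sgn_ratio /hyp (_ : (2 * (k + r) - 1 = 2 * k - 1 + r + r)%N); last by lia.
rewrite !exprD.
have := sqrr_sign R k; have := sqrr_sign R r.
have := expf_neq0 r w0; have := expf_neq0 (2 * k - 1) w0.
set s := _ ^+ k; set t := (-1) ^+ r; set A := _ ^+ (2 * k - 1); set B := w ^+ r.
move=> A0 B0 t2 s2 /andP[n1 n2] /andP[n3 n4].
(* Here [A * B * B] is [w ^+ (2 * (k + r) - 1)] and [s * t] is its sign; the factorization relies on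
   [s ^+ 2 = 1]. *)
have -> : A * B - t / (A * B) + - s * (B - t / B) =
    (A - s) * (A * B * B + s * t) / (A * B).
  have -> : (A - s) * (A * B * B + s * t) =
    A * A * B * B + s * t * A - s * A * B * B - s ^+ 2 * t by ring.
  by rewrite s2; field; rewrite A0 B0.
have -> : A * B - t / (A * B) + s * (B - t / B) =
    (A + s) * (A * B * B - s * t) / (A * B).
  have -> : (A + s) * (A * B * B - s * t) =
    A * A * B * B - s * t * A + s * A * B * B - s ^+ 2 * t by ring.
  by rewrite s2; field; rewrite A0 B0.
by field; rewrite ?A0 ?B0 ?n2 ?n3 ?n4.
Qed.

(** The constant [c] cancels in each quotient. It is the [sqrt5] of Binet's formula when [U] and [V]
    are both Fibonacci numbers, and 1 otherwise. *)
Lemma infprod_hyp w c r (U : nat -> R) (V : R) : 1 < w -> c != 0 ->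
  (forall k, (0 < k)%N -> c * U k = hyp w r (2 * k - 1 + r)) ->
  c * V = hyp w r r ->
  infprod_eq (fun k => (U k + (-1) ^+ (k - 1) * V) / (U k + (-1) ^+ k * V))
    (\prod_(1 <= k < r.+1) sgn_ratio w k).
Proof.
move=> w1 c0 cU cV.
apply: eq_infprod (infprod_shift_ratio _ r _ _).
- move=> k k0; rewrite -sgn_ratio_shift // -cU // -cV.
  by rewrite !(mulrCA _ c) -!mulrDr invfM mulrACA divff // mul1r.
- by move=> k; exact: sgn_ratio_neq0.
- exact: cvg_sgn_ratio.
Qed.

(* With w = exp x, this is coth (j x / 2). *)
Definition coth_half w j : R := (w ^+ j + 1) / (w ^+ j - 1).

(** Consecutive factors are paired: an odd index gives [coth_half] at an exponent [4 * k - 3], an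
    even index its inverse at [4 * k - 1]. *)
Lemma prod_sgn_ratio_even w q :
  \prod_(1 <= k < (2 * q).+1) sgn_ratio w k =
  \prod_(1 <= k < q.+1) (coth_half w (4 * k - 3) / coth_half w (4 * k - 1)).
Proof.
elim: q => [|q IH]; first by rewrite !big_geq.
rewrite [RHS]big_nat_recr //= -IH (_ : (2 * q.+1 = (2 * q).+2)%N); last by lia.
rewrite (@big_nat_recr _ _ _ (2 * q).+2) //= (@big_nat_recr _ _ _ (2 * q).+1) //=.
rewrite -mulrA; congr (_ * (_ * _)); rewrite /sgn_ratio /coth_half.
  rewrite (_ : (2 * (2 * q).+1 - 1 = 4 * q.+1 - 3)%N); last by lia.
  by rewrite -signr_odd /= oddM expr1 opprK.
rewrite (_ : (2 * (2 * q).+2 - 1 = 4 * q.+1 - 1)%N); last by lia.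
by rewrite -signr_odd /= oddM expr0 invfM invrK mulrC.
Qed.

(** The last factor has odd index and stays unpaired, whence [q] factors of one kind and [q - 1] of
    the other. *)
Lemma prod_sgn_ratio_odd w q : (0 < q)%N ->
  \prod_(1 <= k < (2 * q - 1).+1) sgn_ratio w k =
  \prod_(1 <= k < q.+1) coth_half w (4 * k - 3) *
  \prod_(1 <= k < (q - 1).+1) (coth_half w (4 * k - 1))^-1.
Proof.
case: q => // q _.
rewrite (_ : (2 * q.+1 - 1 = (2 * q).+1)%N); last by lia.
rewrite big_nat_recr //= prod_sgn_ratio_even big_split /= subn1 /=.
rewrite [in RHS]big_nat_recr //= mulrAC; congr (_ * _ * _).
rewrite /sgn_ratio /coth_half.
rewrite (_ : (2 * (2 * q).+1 - 1 = 4 * q.+1 - 3)%N); last by lia.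
by rewrite -signr_odd /= oddM expr1 opprK.
Qed.

End InfiniteProducts.

(** * The golden ratio and Binet's formulas *)

Section Binet.
Variable R : realType.
Let s5 : R := Num.sqrt 5.

Lemma sqrt5_gt0 : 0 < s5. Proof. by rewrite sqrtr_gt0; lra. Qed.

Lemma sqrt5_sqr : s5 ^+ 2 = 5. Proof. by rewrite sqr_sqrtr //; lra. Qed.

Definition phi : R := (1 + s5) / 2.

Lemma phi_gt1 : 1 < phi.
Proof.
have := sqrt5_sqr; have := sqrt5_gt0; rewrite /phi => h1 h2.
by nra.
Qed.

Lemma phi_neq0 : phi != 0.
Proof. by apply: lt0r_neq0; have := phi_gt1; lra. Qed.

Lemma phi_sqr : phi ^+ 2 = phi + 1.
Proof.
have h := sqrt5_sqr.
have -> : phi ^+ 2 = (1 + 2 * s5 + s5 ^+ 2) / 4 by rewrite /phi; field.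
by rewrite h /phi; field.
Qed.

Lemma phi_inv : phi^-1 = phi - 1.
Proof.
apply: (mulfI phi_neq0); rewrite divff ?phi_neq0 // mulrBr mulr1 -expr2 phi_sqr.
by ring.
Qed.

Lemma sqrt5_phi : s5 = phi + phi^-1.
Proof. by rewrite phi_inv /phi; field. Qed.

Lemma pair_ind (P : nat -> Prop) : P 0%N -> P 1%N ->
  (forall j, P j -> P j.+1 -> P j.+2) -> forall j, P j.
Proof.
move=> P0 P1 PS j; suff [] : P j /\ P j.+1 by [].
by elim: j => // j [? ?]; split=> //; exact: PS.
Qed.

(** The conjugate [- phi^-1] is the other root of [x ^+ 2 = x + 1], so its powers obey the Fibonacci
    recurrence too. *)
Lemma exprN1_phiV_rec j : (-1) ^+ j.+2 * phi ^- j.+2 =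
  (-1) ^+ j.+1 * phi ^- j.+1 + (-1) ^+ j * phi ^- j :> R.
Proof.
have h : phi^-1 ^+ 2 = 1 - phi^-1.
  have -> : phi^-1 ^+ 2 = phi ^+ 2 - 2 * phi + 1 by rewrite phi_inv; ring.
  by rewrite phi_sqr phi_inv; ring.
rewrite -!exprVn -!exprMn_comm; try exact: mulrC.
rewrite !exprS.
rewrite [LHS](_ : _ = (phi^-1 ^+ 2) * (-1 * phi^-1) ^+ j); last by ring.
by rewrite h; ring.
Qed.

Lemma fib_binet j : s5 * (fib j)%:R = phi ^+ j - (-1) ^+ j * phi ^- j.
Proof.
elim/pair_ind: j => [||j IH IH1].
- by rewrite mulr0 !expr0; field.
- by rewrite mulr1 !expr1 mulN1r opprK sqrt5_phi.
- rewrite (_ : fib j.+2 = (fib j.+1 + fib j)%N) // natrD mulrDr IH IH1.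
  rewrite exprN1_phiV_rec (_ : phi ^+ j.+2 = phi ^+ j.+1 + phi ^+ j); first ring.
  by rewrite -addn2 exprD phi_sqr exprS; ring.
Qed.

Lemma lucas_binet j : (lucas j)%:R = phi ^+ j + (-1) ^+ j * phi ^- j.
Proof.
elim/pair_ind: j => [||j IH IH1].
- by rewrite /= !expr0 invr1 mulr1.
- by rewrite /= !expr1 mulN1r phi_inv; ring.
- rewrite (_ : lucas j.+2 = (lucas j.+1 + lucas j)%N) // natrD IH IH1.
  rewrite exprN1_phiV_rec (_ : phi ^+ j.+2 = phi ^+ j.+1 + phi ^+ j); first ring.
  by rewrite -addn2 exprD phi_sqr exprS; ring.
Qed.

(** * Translation between hyperbolic expressions and Fibonacci and Lucas numbers *)

Lemma fib_hyp m r j : odd (m * j) = odd r ->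
  s5 * (fib (m * j))%:R = hyp R (phi ^+ m) r j.
Proof.
by move=> mr; rewrite fib_binet /hyp -exprM -(signr_odd _ r) -mr signr_odd.
Qed.

(** The parities must now be opposite, because Binet's formula for Lucas numbers has a plus sign
    where [hyp] has a minus. *)
Lemma lucas_hyp m r j : odd (m * j) = ~~ odd r ->
  (lucas (m * j))%:R = hyp R (phi ^+ m) r j.
Proof.
move=> mr; rewrite lucas_binet /hyp -exprM -(signr_odd _ (m * j)) mr -(signr_odd _ r).
by case: (odd r); rewrite /= ?expr0 ?expr1; ring.
Qed.

Lemma phiX_gt1 m : (0 < m)%N -> 1 < phi ^+ m.
Proof. by move=> m0; rewrite exprn_egt1 ?phi_gt1 // -lt0n. Qed.

(** With [X = phi ^+ (p * j)], the left side is [(X + X^-1) / (X - X^-1)]; as [p * j] is even, Binet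
    reads this as Lucas over [s5] times Fibonacci. *)
Lemma coth_half_even p j : (0 < p)%N -> (0 < j)%N -> ~~ odd p ->
  coth_half R (phi ^+ (2 * p)) j =
  s5^-1 * ((lucas (p * j))%:R / (fib (p * j))%:R).
Proof.
move=> p0 j0 pe; rewrite mulrCA -invfM fib_binet lucas_binet.
rewrite -(signr_odd _ (p * j)) oddM (negbTE pe) expr0 !mul1r /coth_half.
rewrite -exprM -mulnA mulnC exprM.
have := phiX_gt1 (p * j)%N; rewrite muln_gt0 p0 j0 => /(_ isT).
set X := _ ^+ (p * j) => X1.
have X0 : X != 0 by apply: lt0r_neq0; lra.
have n1 : X ^+ 2 - 1 != 0 by apply: lt0r_neq0; nra.
by field; rewrite X0 n1.
Qed.

(** For odd [p * j] the signs in Binet's formulas flip, so Fibonacci and Lucas numbers trade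
    places. *)
Lemma coth_half_odd p j : odd p -> odd j ->
  coth_half R (phi ^+ (2 * p)) j =
  s5 * ((fib (p * j))%:R / (lucas (p * j))%:R).
Proof.
move=> po jo; rewrite mulrA fib_binet lucas_binet.
rewrite -(signr_odd _ (p * j)) oddM po jo expr1 /coth_half.
rewrite -exprM -mulnA mulnC exprM.
have := phiX_gt1 (p * j)%N; rewrite muln_gt0 !odd_gt0 // => /(_ isT).
set X := _ ^+ (p * j) => X1.
have X0 : X != 0 by apply: lt0r_neq0; lra.
have n1 : X ^+ 2 - 1 != 0 by apply: lt0r_neq0; nra.
by field; rewrite X0 n1.
Qed.

(** Without the doubled exponent, multiply [(X + 1) / (X - 1)] above and below by [(X + 1) / X]:
    this gives [(X + X^-1 + 2) / (X - X^-1)], the origin of the constant 2. *)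
Lemma coth_half_odd1 p j : odd p -> odd j ->
  coth_half R (phi ^+ p) j =
  ((fib (p * j))%:R * s5 + 2) / (lucas (p * j))%:R.
Proof.
move=> po jo; rewrite mulrC (mulrC _ s5) fib_binet lucas_binet.
rewrite -(signr_odd _ (p * j)) oddM po jo expr1 /coth_half -exprM.
have := phiX_gt1 (p * j)%N; rewrite muln_gt0 !odd_gt0 // => /(_ isT).
set X := _ ^+ (p * j) => X1.
have X0 : X != 0 by apply: lt0r_neq0; lra.
have n1 : X - 1 != 0 by apply: lt0r_neq0; lra.
have n2 : X ^+ 2 - 1 != 0 by apply: lt0r_neq0; nra.
by field; rewrite X0 n1 n2.
Qed.

End Binet.

(** * Assembly of the six identities *)

(** There is one more [c] than [c^-1], so a single [c] survives: the prefactor of the fourth and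
    fifth identities. *)
Lemma prod_split_scale (R : realType) (c : R) (a b : nat -> R) q :
  c != 0 -> (0 < q)%N ->
  \prod_(1 <= k < q.+1) (c * a k) * \prod_(1 <= k < (q - 1).+1) (c * b k)^-1 =
  c * \prod_(1 <= k < q.+1) a k * \prod_(1 <= k < (q - 1).+1) (b k)^-1.
Proof.
move=> c0; case: q => // q _; rewrite subn1 /=.
elim: q => [|q IH]; first by rewrite !big_nat1 !big_geq // mulr1.
rewrite big_nat_recr //= [X in _ * X]big_nat_recr //= mulrACA IH.
rewrite [in RHS]big_nat_recr //= [X in _ = _ * X]big_nat_recr //= invfM.
by rewrite [RHS](_ : _ = c * (\prod_(1 <= k < q.+2) a k) *
  (\prod_(1 <= k < q.+1) (b k)^-1) * (a q.+2 * (b q.+1)^-1));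
  [congr (_ * _); rewrite mulrACA mulfV // mul1r|ring].
Qed.

Theorem theorem4 (R : realType) (q n : nat) (hq : (0 < q)%N) (hn : (0 < n)%N) :
  let F (j : nat) : R := (fib j)%:R in
  let L (j : nat) : R := (lucas j)%:R in
  let sqrt5 : R := Num.sqrt 5 in
  infprod_eq
    (fun k : nat =>
      (F (8 * n * k + 8 * n * q - 4 * n)%N
         + (-1) ^+ (k - 1) * F (8 * n * q)%N)
      / (F (8 * n * k + 8 * n * q - 4 * n)%N
         + (-1) ^+ k * F (8 * n * q)%N))
    (\prod_(1 <= k < q.+1)
      ((L (2 * n * (4 * k - 3))%N * F (2 * n * (4 * k - 1))%N)
       / (F (2 * n * (4 * k - 3))%N * L (2 * n * (4 * k - 1))%N)))
  /\
  infprod_eq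
    (fun k : nat =>
      (F ((4 * n - 2) * (2 * q + 2 * k - 1))%N
         + (-1) ^+ (k - 1) * F ((2 * n - 1) * (4 * q))%N)
      / (F ((4 * n - 2) * (2 * q + 2 * k - 1))%N
         + (-1) ^+ k * F ((2 * n - 1) * (4 * q))%N))
    (\prod_(1 <= k < q.+1)
      ((F ((2 * n - 1) * (4 * k - 3))%N * L ((2 * n - 1) * (4 * k - 1))%N)
       / (L ((2 * n - 1) * (4 * k - 3))%N * F ((2 * n - 1) * (4 * k - 1))%N)))
  /\
  infprod_eq
    (fun k : nat =>
      (L ((2 * n - 1) * (2 * q + 2 * k - 1))%N
         + (-1) ^+ (k - 1) * sqrt5 * F ((2 * n - 1) * (2 * q))%N)
      / (L ((2 * n - 1) * (2 * q + 2 * k - 1))%N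
         + (-1) ^+ k * sqrt5 * F ((2 * n - 1) * (2 * q))%N))
    (\prod_(1 <= k < q.+1)
      (((F ((2 * n - 1) * (4 * k - 3))%N * sqrt5 + 2)
          * L ((2 * n - 1) * (4 * k - 1))%N)
       / ((F ((2 * n - 1) * (4 * k - 1))%N * sqrt5 + 2)
          * L ((2 * n - 1) * (4 * k - 3))%N)))
  /\
  infprod_eq
    (fun k : nat =>
      (L (8 * n * (k + q - 1))%N
         + (-1) ^+ (k - 1) * L (4 * n * (2 * q - 1))%N)
      / (L (8 * n * (k + q - 1))%N
         + (-1) ^+ k * L (4 * n * (2 * q - 1))%N))
    (1 / sqrt5
     * (\prod_(1 <= k < q.+1)
          (L (2 * n * (4 * k - 3))%N / F (2 * n * (4 * k - 3))%N))
     * (\prod_(1 <= k < (q - 1).+1)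
          (F (2 * n * (4 * k - 1))%N / L (2 * n * (4 * k - 1))%N)))
  /\
  infprod_eq
    (fun k : nat =>
      (L ((8 * n - 4) * (k + q - 1))%N
         + (-1) ^+ (k - 1) * L ((4 * n - 2) * (2 * q - 1))%N)
      / (L ((8 * n - 4) * (k + q - 1))%N
         + (-1) ^+ k * L ((4 * n - 2) * (2 * q - 1))%N))
    (sqrt5
     * (\prod_(1 <= k < q.+1)
          (F ((2 * n - 1) * (4 * k - 3))%N / L ((2 * n - 1) * (4 * k - 3))%N))
     * (\prod_(1 <= k < (q - 1).+1)
          (L ((2 * n - 1) * (4 * k - 1))%N / F ((2 * n - 1) * (4 * k - 1))%N)))
  /\
  infprod_eq
    (fun k : nat =>
      (L ((4 * n - 2) * (q + k - 1))%N
         + (-1) ^+ (k - 1) * sqrt5 * F ((2 * n - 1) * (2 * q - 1))%N)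
      / (L ((4 * n - 2) * (q + k - 1))%N
         + (-1) ^+ k * sqrt5 * F ((2 * n - 1) * (2 * q - 1))%N))
    ((\prod_(1 <= k < q.+1)
        ((F ((2 * n - 1) * (4 * k - 3))%N * sqrt5 + 2)
         / L ((2 * n - 1) * (4 * k - 3))%N))
     * (\prod_(1 <= k < (q - 1).+1)
          (L ((2 * n - 1) * (4 * k - 1))%N
           / (F ((2 * n - 1) * (4 * k - 1))%N * sqrt5 + 2)))).
Proof.
move=> F L sqrt5.
have c0 : sqrt5 != 0 := lt0r_neq0 (sqrt5_gt0 R).
have i0 : sqrt5^-1 != 0 by rewrite invr_eq0.
set p := (2 * n - 1)%N.
have po : odd p by rewrite /p; lia.
have p0 : (0 < p)%N by rewrite odd_gt0.
have Ep : (4 * n - 2 = 2 * p)%N by rewrite /p; lia.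
have Ep' : (8 * n - 4 = 4 * p)%N by rewrite /p; lia.
have dq : (0 < 2 * q - 1)%N by lia.
have oq : odd (2 * q - 1) by lia.
have o3 k : (0 < k)%N -> odd (4 * k - 3) by lia.
have o1 k : (0 < k)%N -> odd (4 * k - 1) by lia.
have g3 k : (0 < k)%N -> (0 < 4 * k - 3)%N by lia.
have g1 k : (0 < k)%N -> (0 < 4 * k - 1)%N by lia.
have n2 : ~~ odd (2 * n) by lia.
have n20 : (0 < 2 * n)%N by lia.
rewrite Ep Ep'; split; [|split; [|split; [|split; [|split]]]].
(* First identity: [w = phi ^+ (4 * n)], [r = 2 * q]. *)
- have -> : \prod_(1 <= k < q.+1)
      ((L (2 * n * (4 * k - 3))%N * F (2 * n * (4 * k - 1))%N)
       / (F (2 * n * (4 * k - 3))%N * L (2 * n * (4 * k - 1))%N)) =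
      \prod_(1 <= k < (2 * q).+1) sgn_ratio R (phi R ^+ (2 * (2 * n))) k.
    rewrite prod_sgn_ratio_even; apply: eq_prod_pos => k k0.
    rewrite !coth_half_even ?g1 ?g3 // -/sqrt5 /F /L.
    (* The two factors [sqrt5^-1] of a pair cancel; they are introduced on the left as a quotient
       equal to 1. *)
    by rewrite !invfM !invrK; rewrite -[LHS]mul1r -(mulfV i0) invrK; ring.
  apply: (@infprod_hyp _ _ sqrt5) => //.
  + by apply: phiX_gt1; lia.
  + move=> k k0; rewrite /F (_ : (8 * n * k + 8 * n * q - 4 * n =
      2 * (2 * n) * (2 * k - 1 + 2 * q))%N); last first.
      by case: k k0 => // k _; rewrite (_ : 2 * k.+1 - 1 = 2 * k + 1)%N; lia.
    by apply: fib_hyp; rewrite -mulnA !oddM.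
  + rewrite /F (_ : (8 * n * q = 2 * (2 * n) * (2 * q))%N); last by lia.
    by apply: fib_hyp; rewrite -mulnA !oddM.
(* Second identity: [w = phi ^+ (4 * n - 2)], [r = 2 * q]. *)
- have -> : \prod_(1 <= k < q.+1)
      ((F (p * (4 * k - 3))%N * L (p * (4 * k - 1))%N)
       / (L (p * (4 * k - 3))%N * F (p * (4 * k - 1))%N)) =
      \prod_(1 <= k < (2 * q).+1) sgn_ratio R (phi R ^+ (2 * p)) k.
    rewrite prod_sgn_ratio_even; apply: eq_prod_pos => k k0.
    rewrite !coth_half_odd ?o1 ?o3 // -/sqrt5 /F /L.
    by rewrite !invfM !invrK; rewrite -[LHS]mul1r -(mulfV c0); ring.
  apply: (@infprod_hyp _ _ sqrt5) => //.
  + by apply: phiX_gt1; lia.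
  + move=> k k0; rewrite /F (_ : (2 * q + 2 * k - 1 = 2 * k - 1 + 2 * q)%N); last by lia.
    by apply: fib_hyp; rewrite -mulnA !oddM.
  + rewrite /F (_ : (p * (4 * q) = 2 * p * (2 * q))%N); last by lia.
    by apply: fib_hyp; rewrite -mulnA !oddM.
(* Third identity: [w = phi ^+ (2 * n - 1)], [r = 2 * q]; Lucas indices are odd, the Fibonacci index
   is even. *)
- have -> : \prod_(1 <= k < q.+1)
      (((F (p * (4 * k - 3))%N * sqrt5 + 2) * L (p * (4 * k - 1))%N)
       / ((F (p * (4 * k - 1))%N * sqrt5 + 2) * L (p * (4 * k - 3))%N)) =
      \prod_(1 <= k < (2 * q).+1) sgn_ratio R (phi R ^+ p) k.
    rewrite prod_sgn_ratio_even; apply: eq_prod_pos => k k0.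
    rewrite !coth_half_odd1 ?o1 ?o3 // -/sqrt5 /F /L.
    by rewrite !invfM !invrK; ring.
  (* Regrouping makes [V] the product of [sqrt5] and a Fibonacci number, so that [c = 1] fits both
     terms. *)
  under eq_fun do rewrite -!(mulrA _ sqrt5).
  apply: (@infprod_hyp _ _ 1) => //.
  + by apply: phiX_gt1; lia.
  + move=> k k0; rewrite mul1r /L (_ : (2 * q + 2 * k - 1 = 2 * k - 1 + 2 * q)%N); last by lia.
    by apply: lucas_hyp; rewrite !oddM; lia.
  + by rewrite mul1r; apply: fib_hyp; rewrite !oddM andbF.
(* Fourth identity: [w = phi ^+ (4 * n)], [r = 2 * q - 1]. *)
- have -> : 1 / sqrt5
     * (\prod_(1 <= k < q.+1)
          (L (2 * n * (4 * k - 3))%N / F (2 * n * (4 * k - 3))%N))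
     * (\prod_(1 <= k < (q - 1).+1)
          (F (2 * n * (4 * k - 1))%N / L (2 * n * (4 * k - 1))%N)) =
      \prod_(1 <= k < (2 * q - 1).+1) sgn_ratio R (phi R ^+ (2 * (2 * n))) k.
    rewrite prod_sgn_ratio_odd //.
    under [X in _ = X * _]eq_prod_pos => k k0 do
      rewrite coth_half_even ?g1 ?g3 // -/sqrt5.
    under [X in _ = _ * X]eq_prod_pos => k k0 do
      rewrite coth_half_even ?g1 ?g3 // -/sqrt5.
    rewrite prod_split_scale // div1r; congr (_ * _).
    by apply: eq_prod_pos => k k0; rewrite invfM invrK mulrC.
  apply: (@infprod_hyp _ _ 1) => //.
  + by apply: phiX_gt1; lia.
  + move=> k k0; rewrite mul1r /L (_ : (8 * n * (k + q - 1) =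
      2 * (2 * n) * (2 * k - 1 + (2 * q - 1)))%N); last first.
      by rewrite (_ : 2 * k - 1 + _ = 2 * (k + q - 1))%N; lia.
    by apply: lucas_hyp; rewrite -mulnA !oddM oq.
  + rewrite mul1r /L (_ : (4 * n = 2 * (2 * n))%N); last by lia.
    by apply: lucas_hyp; rewrite -mulnA !oddM oq.
(* Fifth identity: [w = phi ^+ (4 * n - 2)], [r = 2 * q - 1]. *)
- have -> : sqrt5
     * (\prod_(1 <= k < q.+1)
          (F (p * (4 * k - 3))%N / L (p * (4 * k - 3))%N))
     * (\prod_(1 <= k < (q - 1).+1)
          (L (p * (4 * k - 1))%N / F (p * (4 * k - 1))%N)) =
      \prod_(1 <= k < (2 * q - 1).+1) sgn_ratio R (phi R ^+ (2 * p)) k.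
    rewrite prod_sgn_ratio_odd //.
    under [X in _ = X * _]eq_prod_pos => k k0 do
      rewrite coth_half_odd ?o1 ?o3 // -/sqrt5.
    under [X in _ = _ * X]eq_prod_pos => k k0 do
      rewrite coth_half_odd ?o1 ?o3 // -/sqrt5.
    rewrite prod_split_scale //; congr (_ * _).
    by apply: eq_prod_pos => k k0; rewrite invfM invrK mulrC.
  apply: (@infprod_hyp _ _ 1) => //.
  + by apply: phiX_gt1; lia.
  + move=> k k0; rewrite mul1r /L (_ : (4 * p * (k + q - 1) =
      2 * p * (2 * k - 1 + (2 * q - 1)))%N); last first.
      by rewrite (_ : 2 * k - 1 + _ = 2 * (k + q - 1))%N; lia.
    by apply: lucas_hyp; rewrite -mulnA !oddM oq.
  + rewrite mul1r /L.
    by apply: lucas_hyp; rewrite -mulnA !oddM oq.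
(* Sixth identity: [w = phi ^+ (2 * n - 1)], [r = 2 * q - 1]; Lucas indices are even, the Fibonacci
   index is odd. *)
- have -> : (\prod_(1 <= k < q.+1)
        ((F (p * (4 * k - 3))%N * sqrt5 + 2) / L (p * (4 * k - 3))%N))
     * (\prod_(1 <= k < (q - 1).+1)
          (L (p * (4 * k - 1))%N / (F (p * (4 * k - 1))%N * sqrt5 + 2))) =
      \prod_(1 <= k < (2 * q - 1).+1) sgn_ratio R (phi R ^+ p) k.
    rewrite prod_sgn_ratio_odd //.
    congr (_ * _); apply: eq_prod_pos => k k0; rewrite coth_half_odd1 ?o1 ?o3 //.
    by rewrite invfM invrK mulrC.
  under eq_fun do rewrite -!(mulrA _ sqrt5).
  apply: (@infprod_hyp _ _ 1) => //.
  + by apply: phiX_gt1; lia.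
  + move=> k k0; rewrite mul1r /L (_ : (2 * p * (q + k - 1) =
      p * (2 * k - 1 + (2 * q - 1)))%N); last first.
      by rewrite (_ : 2 * k - 1 + _ = 2 * (q + k - 1))%N; lia.
    by apply: lucas_hyp; rewrite oddM oq; lia.
  + by rewrite mul1r; apply: fib_hyp; rewrite !oddM po oq.
Qed.
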